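(* Let $n\ge 3$ be an integer and let $u_f$ ($1\le f\le n$) be a vertex of $P(n,2)$ of the type $u_i$. Let $P_f(n,2)=P(n,2)-u_f$ be the graph obtained from $P(n,2)$ by deleting $u_f$. Then $$\gamma(P_f(n,2))=\begin{cases}\gamma(P(n,2))-1 & \text{if } n=5k+1 \text{ or } n=5k+2 \text{ for some integer } k,\\ \gamma(P(n,2)) & \text{otherwise.}\end{cases}$$
   Context: $\gamma(G)$ denotes the domination number of a graph $G$: the minimum cardinality of a set $S\subseteq V(G)$ such that every vertex of $G$ is in $S$ or adjacent to a vertex of $S$. The generalized Petersen graph $P(n,2)$ is the simple graph with $2n$ vertices $u_1,\dots,u_n,v_1,\dots,v_n$ and edges $u_iu_{i+1}$, $u_iv_i$, $v_iv_{i+2}$ for $1\le i\le n$, with all subscripts taken modulo $n$ (for $n=3,4$ the graph is given by the same rule, coinciding edges being identified). *)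

(* Defs.v *)
From mathcomp Require Import all_boot.

Set Implicit Arguments.
Unset Strict Implicit.
Unset Printing Implicit Defensive.

(* A finite simple graph is a symmetric irreflexive relation on a finType. *)

Section Domination.
Variables (T : finType) (e : rel T).

Definition dominating (S : {set T}) : bool :=
  [forall x, (x \in S) || [exists y in S, e x y]].

Definition domination_number : nat :=
  #|[arg min_(S < [set: T] | dominating S) #|S|]|.

Lemma dominatingT : dominating [set: T].
Proof. by apply/forallP => x; rewrite inE. Qed.

Lemma domination_numberP :
  (exists2 S, dominating S & #|S| = domination_number) /\
  (forall S, dominating S -> domination_number <= #|S|).
Proof.
rewrite /domination_number; case: arg_minnP; first exact: dominatingT.
by move=> S dS minS; split; [exists S | exact: minS].
Qed.

(* Ensures that the truncated subtraction of 1 from the domination number of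
   a nonempty graph is the true one. *)
Lemma domination_number_gt0 : 0 < #|T| -> 0 < domination_number.
Proof.
move=> /card_gt0P[x _]; have [[S dS <-] _] := domination_numberP.
have /orP[xS | /existsP[y /andP[yS _]]] := forallP dS x; apply/card_gt0P.
  by exists x.
by exists y.
Qed.

(* The subgraph induced on the vertices other than v. *)
Definition del_vertex (v : T) : rel {x : T | x != v} :=
  fun x y => e (val x) (val y).

Lemma del_vertex_sym v : symmetric e -> symmetric (@del_vertex v).
Proof. by move=> se x y; apply: se. Qed.

Lemma del_vertex_irr v : irreflexive e -> irreflexive (@del_vertex v).
Proof. by move=> ie x; apply: ie. Qed.

End Domination.

(* The indices 1, ..., n modulo n are represented by the residues
   0, ..., n - 1, the index n becoming 0; inl i is u_i and inr i is v_i. *)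
Definition pvertex (n : nat) : finType := ('I_n + 'I_n)%type.

Definition u_ n (i : 'I_n) : pvertex n := inl i.

(* [step d i j] : the subscripts i and j are i and i + d modulo n, in either
   order. *)
Definition step n (d : nat) (i j : 'I_n) : bool :=
  (j == i + d %[mod n]) || (i == j + d %[mod n]).

Definition petersen2 n : rel (pvertex n) := fun x y =>
  match x, y with
  | inl i, inl j => step 1 i j
  | inl i, inr j | inr j, inl i => i == j
  | inr i, inr j => step 2 i j
  end.

Lemma petersen2_sym n : symmetric (@petersen2 n).
Proof. by case=> i [] j //=; rewrite /step orbC. Qed.

Lemma petersen2_irr n : 3 <= n -> irreflexive (@petersen2 n).
Proof.
have stepF d (i : 'I_n) : 0 < d -> d < n -> step d i i = false.
  move=> d_gt0 dn; rewrite /step orbb -{1}[i : nat]addn0 eqn_modDl.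
  by rewrite mod0n modn_small // eq_sym eqn0Ngt d_gt0.
by move=> n3 [] i /=; rewrite stepF // ltnW.
Qed.

(* Main.v *)
Require Import Defs.
From mathcomp Require Import all_boot zify.

Set Implicit Arguments.
Unset Strict Implicit.
Unset Printing Implicit Defensive.

(** Write n = 5k + m with m < 5.  Both domination numbers are known exactly:
    that of P(n,2) is the ceiling of 3n/5, and that of P(n,2) - u_f is
    3k + (0, 0, 1, 2 or 3 for m = 0, 1, 2, 3, 4), written [bound n] below.
    The two agree except for m = 1 and m = 2, where they differ by one.

    For the lower bounds, a set of vertices is read as a cyclic word of n
    columns, the i-th column telling which of u_i and v_i are in the set.
    Whether u_i and v_i are dominated depends only on the five columns around
    i, so a cheap dominating set is a cheap closed walk in a finite graph whose
    states are quadruples of consecutive columns.  The least costs of walks of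
    given length and end form a table; tables are computed step by step
    ([relax]), and after a few steps a table grows by at least 3 every five
    steps, which makes finitely many evaluations a proof for every n.
    Started from arbitrary states, the tables give 3n <= 5|S| for dominating
    sets S: the walk is followed five times around the cycle, so that its
    length is a multiple of five and its end is its start
    ([dominating_bound]).  When u_f is not dominated, the column of f is empty
    and its two neighbours contain no u, which leaves sixteen states around
    f; a table for each of them gives |S| >= bound n
    ([almost_dominating_bound]).  The average growth rate would not be enough
    here: it does not exclude |S| = 3k + 2 for n = 5k + 4, so the start of the
    walk has to be remembered.

    For the upper bounds, five columns holding three vertices are repeated,
    together with at most four other columns.  Where the deletion helps, the
    pattern is an empty column followed by blocks (empty, v, v, empty, u):
    the two adjacent empty columns leave only u_f undominated
    ([optimal_set]). *)

Local Notation empty := (false, false).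
Local Notation only_u := (true, false).
Local Notation only_v := (false, true).

(** * Deleting a vertex *)

Definition dominated (T : finType) (e : rel T) (S : {set T}) (x : T) : bool :=
  (x \in S) || [exists y in S, e x y].

Lemma leq_domination_number_del (T : finType) (e : rel T) (v : T) m :
    (forall S : {set T}, v \notin S ->
       (forall x, x != v -> dominated e S x) -> m <= #|S|) ->
  m <= domination_number (del_vertex e (v := v)).
Proof.
move=> lb; have [[S domS <-] _] := domination_numberP (del_vertex e (v := v)).
rewrite -(card_imset (mem S) val_inj); apply: lb => [|x xv].
  by apply/imsetP => -[[y yv] _ /= vy]; rewrite vy eqxx in yv.
have /orP[xS | /existsP[y /andP[yS exy]]] := forallP domS (Sub x xv).
  by apply/orP; left; apply/imsetP; exists (Sub x xv).
apply/orP; right; apply/existsP; exists (val y).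
by rewrite imset_f.
Qed.

Lemma domination_number_del_leq (T : finType) (e : rel T) (v : T) (S : {set T}) :
    v \notin S -> (forall x, x != v -> dominated e S x) ->
  domination_number (del_vertex e (v := v)) <= #|S|.
Proof.
move=> vS domS; set S' := [set x : {x : T | x != v} | val x \in S].
have -> : #|S| = #|S'|.
  rewrite -(card_imset (mem S') val_inj); apply: eq_card => x.
  apply/idP/imsetP => [xS | [y yS ->]]; last by rewrite inE in yS.
  have xv : x != v by apply: contraNneq vS => <-.
  by exists (Sub x xv); rewrite ?inE.
apply: (domination_numberP (del_vertex e (v := v))).2; apply/forallP => x.
have /orP[xS | /existsP[y /andP[yS exy]]] := domS (val x) (valP x).
  by rewrite inE xS.
have yv : y != v by apply: contraNneq vS => <-.
by apply/orP; right; apply/existsP; exists (Sub y yv); rewrite inE yS.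
Qed.

Lemma domination_number_leq_del (T : finType) (e : rel T) (v : T) :
  domination_number e <= (domination_number (del_vertex e (v := v))).+1.
Proof.
have [_ lb] := domination_numberP e.
have [[S domS <-] _] := domination_numberP (del_vertex e (v := v)).
apply: leq_trans (lb (v |: [set val x | x in S]) _) _; last first.
  by rewrite cardsU1 (card_imset _ val_inj) -add1n leq_add2r leq_b1.
apply/forallP => x; rewrite in_setU1; have [//|xv] := eqVneq x v.
have /orP[xS | /existsP[y /andP[yS exy]]] := forallP domS (Sub x xv).
  by apply/orP; left; apply/imsetP; exists (Sub x xv).
apply/orP; right; apply/existsP; exists (val y).
by rewrite in_setU1 imset_f ?orbT.
Qed.

(** * The columns of a set of vertices *)

Definition column := (bool * bool)%type.
Definition weight (c : column) : nat := c.1 + c.2.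

(** Domination of the vertex u of the column c, whose neighbours lie in the
    adjacent columns b and d; for the vertex v of c in [inner_ok], they lie in
    the columns a and e two places away. *)
Definition outer_ok (b c d : column) : bool := [|| b.1, c.1, d.1 | c.2].
Definition inner_ok (a c e : column) : bool := [|| a.2, c.2, e.2 | c.1].

Section Columns.
Variable n : nat.
Hypothesis n_gt0 : 0 < n.

Definition wrap i : 'I_n := Ordinal (ltn_pmod i n_gt0).

Lemma wrap_ord (i : 'I_n) : wrap i = i.
Proof. by apply: val_inj; rewrite /= modn_small. Qed.

Lemma eq_wrap i j : i = j %[mod n] -> wrap i = wrap j.
Proof. by move=> ij; apply: val_inj. Qed.

Lemma wrapDn i : wrap (i + n) = wrap i.
Proof. by apply: eq_wrap; rewrite modnDr. Qed.

Lemma step_wrap d i j :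
  step d (wrap (i + d)) j = (j == wrap (i + d + d)) || (j == wrap i).
Proof.
rewrite -(inj_eq val_inj) -[j == wrap i](inj_eq val_inj) /step /=.
by rewrite modnDml modn_mod eqn_modDr !(modn_small (ltn_ord j)) [_ == val j]eq_sym.
Qed.

Lemma step1_wrap i j :
  step 1 (wrap i.+1) j = (j == wrap i.+2) || (j == wrap i).
Proof. by have := step_wrap 1 i j; rewrite !addn1. Qed.

Lemma step2_wrap i j :
  step 2 (wrap i.+2) j = (j == wrap i.+4) || (j == wrap i).
Proof. by have := step_wrap 2 i j; rewrite !addn2. Qed.

Definition col (S : {set pvertex n}) i : column :=
  (u_ (wrap i) \in S, (inr (wrap i) : pvertex n) \in S).

Lemma col_periodic S i : col S (i + n) = col S i.
Proof. by rewrite /col wrapDn. Qed.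

Lemma dominated_outer S i :
  dominated (@petersen2 n) S (u_ (wrap i.+1)) =
    outer_ok (col S i) (col S i.+1) (col S i.+2).
Proof.
rewrite /outer_ok /=; apply/idP/idP.
  case/orP => [-> | /existsP[[j|j] /andP[jS]]]; first by rewrite orbT.
    by rewrite /= step1_wrap => /orP[]/eqP<-; rewrite jS ?orbT.
  by rewrite /= => /eqP->; rewrite jS !orbT.
rewrite /dominated => h; case: (boolP (_ \in S)) => //= uS; apply/existsP.
move: h; rewrite (negbTE uS) /=; case/or3P => [h|h|h].
- by exists (u_ (wrap i)); rewrite h /= step1_wrap eqxx orbT.
- by exists (u_ (wrap i.+2)); rewrite h /= step1_wrap eqxx.
- by exists (inr (wrap i.+1)); rewrite h /=.
Qed.

Lemma dominated_inner S i :
  dominated (@petersen2 n) S (inr (wrap i.+2)) =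
    inner_ok (col S i) (col S i.+2) (col S i.+4).
Proof.
rewrite /inner_ok /=; apply/idP/idP.
  case/orP => [-> | /existsP[[j|j] /andP[jS]]]; first by rewrite orbT.
    by rewrite /= => /eqP<-; rewrite jS !orbT.
  by rewrite /= step2_wrap => /orP[]/eqP<-; rewrite jS ?orbT.
rewrite /dominated => h; case: (boolP (_ \in S)) => //= uS; apply/existsP.
move: h; rewrite (negbTE uS) /=; case/or3P => [h|h|h].
- by exists (inr (wrap i)); rewrite h /= step2_wrap eqxx orbT.
- by exists (inr (wrap i.+4)); rewrite h /= step2_wrap eqxx.
- by exists (u_ (wrap i.+2)); rewrite h /=.
Qed.

Lemma wrap_rot_inj a : injective (fun i : 'I_n => wrap (a + i)).
Proof.
move=> i j /(congr1 val)/eqP /=; rewrite eqn_modDl !modn_small // => /eqP.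
exact: val_inj.
Qed.

Lemma wrap_surj a (j : 'I_n) : exists i : 'I_n, j = wrap (a + i).
Proof.
by exists (invF (@wrap_rot_inj a) j); rewrite (f_invF (@wrap_rot_inj a)).
Qed.

Lemma sum_weight a S : \sum_(i < n) weight (col S (a + i)) = #|S|.
Proof.
rewrite -sum1_card [RHS]big_mkcond big_sumType /= -big_split /=.
rewrite [RHS](reindex_inj (@wrap_rot_inj a)) /=.
by apply: eq_bigr => i _; rewrite /weight /col /=; do 2 case: (_ \in S).
Qed.

Lemma col_surj a (c : nat -> column) : (forall i, c (i %% n) = c i) ->
  exists S, forall i, col S (a + i) = c i.
Proof.
move=> cP.
(* Modulo n, a * n.-1 is - a. *)
exists [set x : pvertex n | match x with
   | inl j => (c (j + a * n.-1)).1 | inr j => (c (j + a * n.-1)).2 end].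
move=> i; have e : c ((a + i) %% n + a * n.-1) = c i.
  rewrite -cP modnDml addnAC -mulnS prednK //.
  by rewrite modnMDl cP.
by rewrite /col !inE /= e; case: (c i).
Qed.
End Columns.

(** * Tables of least costs *)

(** Forbidding undominated vertices would make some costs infinite.  Charging
    one for each of them instead, the price of adding it to the set, leaves the
    least total cost unchanged. *)
Definition cost (a b c d e : column) : nat :=
  weight c + ~~ outer_ok b c d + ~~ inner_ok a c e.

Definition columns : seq column :=
  [:: empty; only_v; only_u; (true, true)].

(** A function on the four columns, stored as its four values, so that the
    tables below are computed only once. *)
Inductive quad (A : Type) := Quad of A & A & A & A.

Definition tabulate A (f : column -> A) : quad A :=
  Quad (f empty) (f only_v) (f only_u) (f (true, true)).

Definition at_col A (q : quad A) (c : column) : A :=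
  let: Quad q00 q01 q10 q11 := q in
  match c with
  | (false, false) => q00 | (false, true) => q01
  | (true, false) => q10 | (true, true) => q11
  end.

Lemma at_tabulate A (f : column -> A) c : at_col (tabulate f) c = f c.
Proof. by case: c => [[] []]. Qed.

Definition table := quad (quad (quad (quad nat))).

Definition make (f : column -> column -> column -> column -> nat) : table :=
  tabulate (fun a => tabulate (fun b => tabulate (fun c => tabulate (f a b c)))).

Definition value (t : table) a b c d : nat :=
  at_col (at_col (at_col (at_col t a) b) c) d.

Lemma value_make f a b c d : value (make f) a b c d = f a b c d.
Proof. by rewrite /value !at_tabulate. Qed.

Definition min_col (f : column -> nat) : nat :=
  minn (minn (f empty) (f only_v))
       (minn (f only_u) (f (true, true))).

(** One step of a walk: the state (a, b, c, d) moves to (b, c, d, e) at the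
    cost of the column c. *)
Definition relax (t : table) : table :=
  make (fun b c d e => min_col (fun a => value t a b c d + cost a b c d e)).

Definition zero : table := make (fun _ _ _ _ => 0).

Definition all_states (P : column -> column -> column -> column -> bool) : bool :=
  all (fun a => all (fun b => all (fun c => all (P a b c) columns) columns)
    columns) columns.

Definition gains3 (t t' : table) : bool :=
  all_states (fun a b c d => value t a b c d + 3 <= value t' a b c d).

(** The value K at the states other than (a, b, c, d) is a penalty for starting
    there.  The bounds drawn from this table only use its value 0 at
    (a, b, c, d), so that K may be anything; K = 5 is large enough for them to
    reach [bound]. *)
Definition start (K : nat) a b c d : table :=
  make (fun a' b' c' d' => if (a, b, c, d) == (a', b', c', d') then 0 else K).

(** The domination number of P(n,2) - u_f. *)
Definition bound n := 3 * (n %/ 5) + nth 0 [:: 0; 0; 1; 2; 3] (n %% 5).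

(** Here (a, b, c, d) is the starting state, with b the column of f, and z is
    the column before a.  A closed walk of length n is back at (z, a, b, c)
    after n - 1 steps; its last step, which would charge for the column of f,
    only has to dominate v_f. *)
Definition closes (t : table) n (a b c d : column) : bool :=
  all (fun z => inner_ok z b d ==> (bound n <= value t z a b c)) columns.

(** The tables V 12 and V 17 take care of the lengths n >= 18, the tables before
    V 17 of the lengths from 3 to 17. *)
Definition start_check (a b c d : column) : bool :=
  let t0 := start 5 a b c d in let V := nth t0 (traject relax t0 18) in
  gains3 (V 12) (V 17) &&
  all (fun j => closes (V j) j.+1 a b c d) (iota 2 15).

(** The least costs of the walks of length 5 with free start already grow
    steadily.  Only their existence is recorded, lest the table be unfolded. *)
Lemma steady_table : exists t, gains3 t (iter 5 relax t).
Proof. by exists (iter 5 relax zero); vm_compute. Qed.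

Definition no_u_columns : seq column := [:: empty; only_v].

(** These are the sixteen states around an undominated u_f: its own column is
    empty, the adjacent ones have no u, and the fourth one is arbitrary. *)
Lemma starts_check :
  all (fun a => all (fun c => all (start_check a empty c) columns) no_u_columns)
    no_u_columns.
Proof. by vm_compute. Qed.

Lemma min_col_leq f c : min_col f <= f c.
Proof.
by rewrite /min_col !geq_min; case: c => [[] []]; rewrite leqnn ?orbT.
Qed.

Lemma leq_min_col f m : (forall c, m <= f c) -> m <= min_col f.
Proof. by move=> mf; rewrite /min_col !leq_min !mf. Qed.

Lemma all_columns (P : pred column) : all P columns -> forall c, P c.
Proof. by move=> /allP allP c; apply: allP; case: c => [[] []]. Qed.

Lemma relax_leq t a b c d e :
  value (relax t) b c d e <= value t a b c d + cost a b c d e.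
Proof. by rewrite value_make (min_col_leq _ a). Qed.

(** Soundness of the tables: they bound from below the cost of the actual walk
    along a sequence of columns. *)
Lemma iter_relax_leq (c : nat -> column) t j :
  value (iter j relax t) (c j) (c j.+1) (c j.+2) (c j.+3) <=
  value t (c 0) (c 1) (c 2) (c 3) +
    \sum_(i < j) cost (c i) (c i.+1) (c i.+2) (c i.+3) (c i.+4).
Proof.
elim: j => [|j IHj]; first by rewrite big_ord0 addn0.
rewrite big_ord_recr addnA iterS; apply: leq_trans (relax_leq _ (c j) _ _ _ _) _.
by rewrite leq_add2r.
Qed.

Lemma gains3P t t' :
  reflect (forall a b c d, value t a b c d + 3 <= value t' a b c d) (gains3 t t').
Proof.
apply: (iffP idP) => [h a b c d | h].
  by have := all_columns (all_columns (all_columns (all_columns h a) b) c) d.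
by do 4 apply/allP => ? _; apply: h.
Qed.

(** A table step is monotone and commutes with adding a constant, so a gain of
    3 persists. *)
Lemma gains3_relax t t' : gains3 t t' -> gains3 (relax t) (relax t').
Proof.
move=> /gains3P tt'; apply/gains3P => b c d e; rewrite [leqRHS]value_make.
apply: leq_min_col => a; apply: leq_trans (leq_add (tt' a b c d) (leqnn _)).
by rewrite addnAC leq_add2r relax_leq.
Qed.

Lemma gains3_iter j t t' :
  gains3 t t' -> gains3 (iter j relax t) (iter j relax t').
Proof. by move=> tt'; elim: j => //= j; apply: gains3_relax. Qed.

Lemma gains3_mul t m a b c d : gains3 t (iter 5 relax t) ->
  value t a b c d + 3 * m <= value (iter (m * 5) relax t) a b c d.
Proof.
move=> tt5; elim: m => [|m IHm]; first by rewrite addn0.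
have /gains3P/(_ a b c d) := gains3_iter (m * 5) tt5.
rewrite -iterD (_ : m.+1 * 5 = m * 5 + 5); lia.
Qed.

Lemma boundD5 n : bound (n + 5) = bound n + 3.
Proof. by rewrite /bound modnDr divnDr // mulnDr addnAC. Qed.

(** Induction by steps of five: from j = 17 on, table and bound both grow by 3. *)
Lemma start_closes a b c d j : start_check a b c d -> 2 <= j ->
  closes (iter j relax (start 5 a b c d)) j.+1 a b c d.
Proof.
pose V j := iter j relax (start 5 a b c d); case/andP.
rewrite !nth_traject // => /gains3_iter gain /allP base.
elim/ltn_ind: j => j IHj j2; have [j17 | j17] := ltnP j 17.
  have := base j; rewrite mem_iota nth_traject; last by lia.
  by apply; rewrite j2.
have jE : j = j - 5 + 5 by lia.
have /allP IH : closes (V (j - 5)) (j - 5).+1 a b c d by apply: IHj; lia.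
apply/allP => z zc; have := IH z zc; case: (inner_ok z b d) => //= le_b.
rewrite jE -addSn boundD5.
have /gains3P/(_ z a b c) := gain (j - 17); rewrite -!iterD.
have -> : j - 17 + 12 = j - 5 by lia.
have -> : j - 17 + 17 = j - 5 + 5 by lia.
by apply: leq_trans; rewrite leq_add2r.
Qed.

(** * Lower bounds *)

Section LowerBounds.
Variable n : nat.
Hypothesis n_gt0 : 0 < n.
Local Notation wrap := (wrap n_gt0).
Local Notation col := (col n_gt0).

Lemma cost_dominated S i :
    dominated (@petersen2 n) S (u_ (wrap i.+2)) ->
    dominated (@petersen2 n) S (inr (wrap i.+2)) ->
  cost (col S i) (col S i.+1) (col S i.+2) (col S i.+3) (col S i.+4) =
    weight (col S i.+2).
Proof.
by rewrite dominated_outer dominated_inner /cost => -> ->; rewrite !addn0.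
Qed.

(** Each round on the cycle costs |S| and returns to the same state, while five
    rounds make 5n steps, during which the table gains 3n. *)
Lemma dominating_bound S : dominating (@petersen2 n) S -> 3 * n <= 5 * #|S|.
Proof.
move=> /forallP domS; pose s t := value t (col S 0) (col S 1) (col S 2) (col S 3).
have round t : s (iter n relax t) <= s t + #|S|.
  have := iter_relax_leq (col S) t n.
  have colDn k : col S (k + n) = col S k := col_periodic n_gt0 S k.
  rewrite (colDn 0) (colDn 1) (colDn 2) (colDn 3).
  rewrite -(sum_weight n_gt0 2 S) => h; apply: leq_trans h _; rewrite leq_add2l.
  by apply: leq_sum => i _; rewrite cost_dominated //; apply: domS.
have rounds k t : s (iter (k * n) relax t) <= s t + k * #|S|.
  elim: k => [|k IHk]; first by rewrite addn0.
  by rewrite mulSn iterD (leq_trans (round _)) // mulSn; lia.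
have [t tt5] := steady_table.
have := gains3_mul n (col S 0) (col S 1) (col S 2) (col S 3) tt5.
have := rounds 5 t; rewrite /s [5 * n]mulnC; lia.
Qed.

(** The columns are numbered from the one before f, so that the starting state
    (c 0, ..., c 3) has the empty column of f in second place and the last step
    of the closed walk is the one where u_f is missed. *)
Lemma almost_dominating_bound S (f : 'I_n) : 3 <= n ->
    ~~ dominated (@petersen2 n) S (u_ f) ->
    (forall x, x != u_ f -> dominated (@petersen2 n) S x) ->
  bound n <= #|S|.
Proof.
move=> n3 uf domS; pose a := f + n.-1; pose c i := col S (a + i).
have wrap_f : wrap (a + 1) = f.
  by rewrite -[RHS](wrap_ord n_gt0) -[RHS]wrapDn; congr wrap; lia.
have c_per i : c (i + n) = c i by rewrite /c addnA col_periodic.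
have : ~~ outer_ok (c 0) (c 1) (c 2).
  by rewrite /c addn0 addn1 addn2 -dominated_outer -addn1 wrap_f.
rewrite /outer_ok !negb_or => /and4P[c0 c1 c2 c1'].
have c1E : c 1 = empty.
  by rewrite [c 1]surjective_pairing (negbTE c1) (negbTE c1').
have window i : i < n.-1 ->
    cost (c i) (c i.+1) (c i.+2) (c i.+3) (c i.+4) = weight (c i.+2).
  move=> lt_i; rewrite /c !addnS; apply: cost_dominated; apply: domS => //.
  rewrite -wrap_f (_ : (a + i).+2 = a + 1 + i.+1); last by lia.
  apply/eqP => -[] /eqP; rewrite -{2}[a + 1]addn0 eqn_modDl mod0n modn_small //.
  by lia.
(* The column left out of the sum, c n.+1, is that of f and hence empty. *)
have cardS : #|S| = \sum_(i < n.-1) weight (c i.+2).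
  have sum_last (F : nat -> nat) : \sum_(i < n) F i = \sum_(i < n.-1) F i + F n.-1.
    by case: (n) n_gt0 => // m _; rewrite big_ord_recr.
  rewrite -(sum_weight n_gt0 (a + 2)) (sum_last (fun i => weight (col S (a + 2 + i)))).
  rewrite -addnA -/(c _) (_ : 2 + n.-1 = 1 + n) ?c_per ?c1E ?addn0; last by lia.
  by apply: eq_bigr => i _; rewrite -addnA.
have chk : start_check (c 0) (c 1) (c 2) (c 3).
  have no_uP b : ~~ b.1 -> b \in no_u_columns by case: b => [[] []].
  have /allP/(_ _ (no_uP _ c0))/allP/(_ _ (no_uP _ c2)) := starts_check.
  by move=> /all_columns/(_ (c 3)); rewrite c1E.
have inner : inner_ok (c n.-1) (c 1) (c 3).
  have := domS (inr f) isT; rewrite -wrap_f -wrapDn.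
  rewrite (_ : a + 1 + n = (a + n.-1).+2); last by lia.
  rewrite dominated_inner -!addnS -!/(c _).
  rewrite (_ : n.-1.+2 = 1 + n); last by lia.
  by rewrite (c_per 1) (c_per 3).
have n1 : 2 <= n.-1 by lia.
have := all_columns (start_closes chk n1) (c n.-1).
rewrite inner prednK //= cardS => /leq_trans; apply.
have := iter_relax_leq c (start 5 (c 0) (c 1) (c 2) (c 3)) n.-1.
rewrite prednK // (c_per 0) (c_per 1) (c_per 2).
rewrite [value (start _ _ _ _ _) _ _ _ _]value_make eqxx.
by under eq_bigr do rewrite window //.
Qed.
End LowerBounds.

(** * Periodic patterns *)

Definition word_weight (w : seq column) : nat := sumn [seq weight c | c <- w].

Fixpoint windows_ok (w : seq column) : bool :=
  if w is a :: w' then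
    (if w' is [:: b, c, d, e & _] then outer_ok b c d && inner_ok a c e else true)
      && windows_ok w'
  else true.

Lemma windows_okP x0 w i : windows_ok w -> i + 4 < size w ->
  outer_ok (nth x0 w i.+1) (nth x0 w i.+2) (nth x0 w i.+3) &&
  inner_ok (nth x0 w i) (nth x0 w i.+2) (nth x0 w i.+4).
Proof.
elim: w i => [|a w IHw] [|i] //= /andP[ok_a ok_w]; last exact: IHw.
by case: w ok_a {IHw ok_w} => [|b [|c [|d [|e w]]]].
Qed.

(** A window of five columns cannot reach across four common columns. *)
Lemma windows_ok_glue x s y : 4 <= size s ->
  windows_ok (x ++ s) -> windows_ok (s ++ y) -> windows_ok (x ++ s ++ y).
Proof.
case: s => [|b [|c [|d [|e s]]]] // _; elim: x => // a x IHx.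
move=> /andP[ok_a ok_x] ok_y; apply/andP; split; last exact: IHx.
by case: x ok_a {IHx ok_x} => [|? [|? [|? [|? x]]]].
Qed.

Definition repeat_block k (B : seq column) : seq column := flatten (nseq k B).

Lemma windows_ok_repeat k x B y : 4 <= size B ->
    windows_ok (x ++ B) -> windows_ok (B ++ B) -> windows_ok (B ++ y) ->
  windows_ok (x ++ repeat_block k.+1 B ++ y).
Proof.
move=> B4 xB BB By; rewrite /repeat_block /= -catA; apply: windows_ok_glue => //.
by elim: k => //= k IHk; rewrite -catA windows_ok_glue.
Qed.

Lemma size_repeat k B : size (repeat_block k B) = k * size B.
Proof. by rewrite size_flatten /shape map_nseq sumn_nseq mulnC. Qed.

Lemma word_weight_cat x y : word_weight (x ++ y) = word_weight x + word_weight y.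
Proof. by rewrite /word_weight map_cat sumn_cat. Qed.

Lemma word_weight_repeat k B : word_weight (repeat_block k B) = k * word_weight B.
Proof. by elim: k => //= k IHk; rewrite word_weight_cat IHk. Qed.

Section Words.
Variable n : nat.
Hypothesis n_gt0 : 0 < n.
Local Notation wrap := (wrap n_gt0).
Local Notation col := (col n_gt0).

(** The column of f is the second letter of w.  The n - 1 windows of
    w ++ take 3 w are centred at the columns of the cycle other than that of f,
    whose two vertices are treated by the last two conditions. *)
Lemma set_of_word (f : 'I_n) (w : seq column) (c := nth empty w) :
    3 <= n -> size w = n -> windows_ok (w ++ take 3 w) ->
    ~~ (c 1).1 -> inner_ok empty (c 1) (c (3 %% n)) ->
  exists S : {set pvertex n}, [/\ u_ f \notin S, #|S| = word_weight w,
    forall x, x != u_ f -> dominated (@petersen2 n) S x &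
    outer_ok (c 0) (c 1) (c 2) -> dominated (@petersen2 n) S (u_ f)].
Proof.
move=> n3 sz_w ok_w c1 ok_f; pose a := f + n.-1.
have wrap_f : wrap (a + 1) = f.
  by rewrite -[RHS](wrap_ord n_gt0) -[RHS]wrapDn; congr wrap; lia.
have c_mod i : c (i %% n %% n) = c (i %% n) by rewrite modn_mod.
have [S SE] := col_surj n_gt0 a c_mod.
have SE_small i : i < n -> col S (a + i) = c i by move=> ?; rewrite SE modn_small.
exists S; split.
- have c1E : col S (a + 1) = c 1 by apply: SE_small; lia.
  by move: c1; rewrite -c1E /col wrap_f.
- rewrite -(sum_weight n_gt0 a) /word_weight sumnE big_map (big_nth empty).
  rewrite sz_w big_mkord; by apply: eq_bigr => i _; rewrite SE_small.
- have window i : i < n.-1 ->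
      dominated (@petersen2 n) S (u_ (wrap (a + i).+2)) &&
      dominated (@petersen2 n) S (inr (wrap (a + i).+2)).
    move=> lt_i; rewrite dominated_outer dominated_inner -!addnS !SE.
    have cyc j : j < n + 3 -> c (j %% n) = nth empty (w ++ take 3 w) j.
      move=> lt_j; rewrite nth_cat sz_w; case: ltnP => [lt_jn | le_nj].
        by rewrite modn_small.
      rewrite nth_take; last by lia.
      by rewrite -{1}(subnK le_nj) modnDr modn_small //; lia.
    rewrite !cyc; try lia; apply: windows_okP => //.
    by rewrite size_cat size_take sz_w; case: ifP; lia.
  case=> j; have [i ->] := wrap_surj n_gt0 (a + 2) j; have lt_in := ltn_ord i.
  + have [lt_i _ | le_i] := ltnP i n.-1.
      by have /andP[] := window i lt_i; rewrite -addn2 addnAC.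
    by rewrite -wrap_f -[wrap (a + 1)]wrapDn (_ : a + 1 + n = a + 2 + i) ?eqxx //; lia.
  have [lt_i _ | le_i _] := ltnP i n.-1.
    by have /andP[] := window i lt_i; rewrite -addn2 addnAC.
  rewrite (_ : a + 2 + i = (a + n.-1).+2); last by lia.
  rewrite dominated_inner -!addnS !SE.
  rewrite (_ : n.-1.+2 = 1 + n); last by lia.
  rewrite -[(1 + n).+2]/(3 + n) !modnDr (modn_small (_ : 1 < n)); last by lia.
  by move: ok_f; rewrite /inner_ok /= => /or3P[->|->|->]; rewrite ?orbT.
- rewrite -(SE_small 0) ?addn0 // -(SE_small 1) -?(SE_small 2) ?addn1 ?addn2; try lia.
  by rewrite -dominated_outer -addn1 wrap_f.
Qed.
End Words.

Lemma boundMD k m : bound (k * 5 + m) = k * 3 + bound m.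
Proof. by rewrite /bound divnMDl // modnMDl mulnDr addnA [3 * k]mulnC. Qed.

(** Outside the residues 1 and 2, the bound is the ceiling of 3n/5. *)
Lemma leq_bound n m : 3 * n <= 5 * m -> bound n <= m.
Proof.
rewrite /bound; have := divn_eq n 5; have := ltn_pmod n (isT : 0 < 5).
by case: (n %% 5) => [|[|[|[|[|//]]]]] _ /=; lia.
Qed.

Lemma set_of_block_word n (f : 'I_n) x B y k (c := nth empty (x ++ B)) :
    4 <= size B -> size x + k.+1 * size B + size y = n ->
    windows_ok (x ++ B) -> windows_ok (B ++ B) ->
    windows_ok (B ++ y ++ take 3 (x ++ B)) ->
    ~~ (c 1).1 -> inner_ok empty (c 1) (c 3) ->
  exists S : {set pvertex n}, [/\ u_ f \notin S,
    #|S| = word_weight x + k.+1 * word_weight B + word_weight y,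
    forall z, z != u_ f -> dominated (@petersen2 n) S z &
    outer_ok (c 0) (c 1) (c 2) -> dominated (@petersen2 n) S (u_ f)].
Proof.
move=> B4 sz_n xB BB By c1 c3; pose w := x ++ repeat_block k.+1 B ++ y.
have wE : w = (x ++ B) ++ repeat_block k B ++ y by rewrite /w /repeat_block /= !catA.
have sz_xB : 4 <= size (x ++ B) by rewrite size_cat (leq_trans B4) ?leq_addl.
have sz_w : size w = n by rewrite !size_cat size_repeat -sz_n addnA.
have n4 : 4 <= n by rewrite -sz_n mulSn; lia.
have nthE i : i < 4 -> nth empty w i = c i.
  by move=> i4; rewrite wE nth_cat (leq_trans i4).
have n_gt0 : 0 < n by lia.
have [||| S [uS cardS domS domf]] := set_of_word n_gt0 f (ltnW n4) sz_w.
- rewrite {2}wE (takel_cat _ (ltnW sz_xB)).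
  have -> : w ++ take 3 (x ++ B) = x ++ repeat_block k.+1 B ++ y ++ take 3 (x ++ B).
    by rewrite /w -!catA.
  exact: windows_ok_repeat.
- by rewrite nthE.
- by rewrite modn_small ?nthE.
exists S; split=> //; last by rewrite -!nthE.
by rewrite cardS !word_weight_cat word_weight_repeat addnA.
Qed.

(** The blocks B serve the residues 1 and 2, where u_f may be missed; the blocks
    C serve the others.  The lengths 3 and 4 are too short for a block. *)
Lemma optimal_set n (f : 'I_n) : 3 <= n ->
  exists S : {set pvertex n}, [/\ u_ f \notin S, #|S| = bound n,
    forall z, z != u_ f -> dominated (@petersen2 n) S z &
    n %% 5 \notin [:: 1; 2] -> dominated (@petersen2 n) S (u_ f)].
Proof.
move=> n3; have n_gt0 : 0 < n by lia.
set goal := (X in exists S, X S).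
have short w (c := nth empty w) : size w = n -> bound n = word_weight w ->
    [&& windows_ok (w ++ take 3 w), ~~ (c 1).1, inner_ok empty (c 1) (c (3 %% n))
      & outer_ok (c 0) (c 1) (c 2)] -> exists S, goal S.
  move=> sz_w wt_w /and4P[ok_w c1 ok_v ok_u].
  have [S [uS cardS domS domf]] := set_of_word n_gt0 f n3 sz_w ok_w c1 ok_v.
  by exists S; split; rewrite ?cardS // => _; apply: domf.
have long x D y k (c := nth empty (x ++ D)) : size D = 5 -> word_weight D = 3 ->
    size x + k.+1 * 5 + size y = n ->
    bound (size x + size y) = word_weight x + word_weight y ->
    [&& windows_ok (x ++ D), windows_ok (D ++ D),
        windows_ok (D ++ y ++ take 3 (x ++ D)), ~~ (c 1).1 &
        inner_ok empty (c 1) (c 3) &&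
        ((n %% 5 \in [:: 1; 2]) || outer_ok (c 0) (c 1) (c 2))] ->
    exists S, goal S.
  move=> sz_D wt_D sz_n wt_xy /and5P[xD DD Dy c1 /andP[ok_v ok_u]].
  have D4 : 4 <= size D by rewrite sz_D.
  have sz_n' : size x + k.+1 * size D + size y = n by rewrite sz_D.
  have [S [uS cardS domS domf]] := set_of_block_word f D4 sz_n' xD DD Dy c1 ok_v.
  exists S; split=> //; last first.
    by move=> n5; apply: domf; move: ok_u; rewrite (negbTE n5).
  have -> : bound n = bound (k.+1 * 5 + (size x + size y)).
    by congr bound; rewrite -sz_n addnAC addnC.
  by rewrite boundMD wt_xy cardS wt_D addnAC addnC.
pose B := [:: empty; only_v; only_v; empty; only_u].
pose C := [:: empty; empty; only_u; only_v; only_u].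
have n_eq := divn_eq n 5; have := ltn_pmod n (isT : 0 < 5).
case: (n %/ 5) n_eq => [|k] n_eq; move: (n %% 5) n_eq long => m n_eq long m5.
- have [n_3|n_4] : n = 3 \/ n = 4 by lia.
  + by apply: (short [:: empty; only_v; only_u]); rewrite n_3.
  + by apply: (short [:: empty; only_v; only_v; only_u]); rewrite n_4.
- case: m m5 n_eq long => [|[|[|[|[|//]]]]] _ n_eq long.
  + by apply: (long [::] C [::] k) => //=; rewrite n_eq; lia.
  + by apply: (long [:: empty] B [::] k) => //=; rewrite n_eq; lia.
  + by apply: (long [:: empty] B [:: only_u] k) => //=; rewrite n_eq; lia.
  + by apply: (long [::] C [:: empty; only_v; only_u] k) => //=; rewrite n_eq; lia.
  + by apply: (long [::] C [:: empty; only_v; only_v; only_u] k) => //=; rewrite n_eq; lia.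
Qed.

Theorem theorem2 (n : nat) (hn : 3 <= n) (f : 'I_n) :
  let gammaP := domination_number (@petersen2 n) in
  let gammaPf := domination_number (del_vertex (@petersen2 n) (v := u_ f)) in
  ((exists k : nat, n = 5 * k + 1 \/ n = 5 * k + 2) -> gammaPf = gammaP - 1) /\
  (~ (exists k : nat, n = 5 * k + 1 \/ n = 5 * k + 2) -> gammaPf = gammaP).
Proof.
move=> gammaP gammaPf; have n_gt0 : 0 < n by lia.
have lbP : 3 * n <= 5 * gammaP.
  have [[S domS cardS] _] := domination_numberP (@petersen2 n).
  by rewrite /gammaP -cardS; apply: dominating_bound.
have lbPf : bound n <= gammaPf.
  apply: leq_domination_number_del => S _ domS.
  have [domf | ] := boolP (dominated (@petersen2 n) S (u_ f)); last first.
    by move=> uf; apply: (almost_dominating_bound n_gt0 hn uf).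
  have domT : dominating (@petersen2 n) S.
    by apply/forallP => x; have [->|/domS] := eqVneq x (u_ f).
  exact: leq_bound (dominating_bound n_gt0 domT).
have [S [uS cardS domS domf]] := optimal_set f hn.
have ubPf : gammaPf <= bound n by rewrite -cardS domination_number_del_leq.
have leP : gammaP <= gammaPf.+1 by apply: domination_number_leq_del.
split=> [[k n_k] | n_k].
- have boundE m : n = 5 * k + m -> bound n = k * 3 + bound m.
    by move=> n_eq; rewrite -boundMD; congr bound; lia.
  have [b1 b2] : bound 1 = 0 /\ bound 2 = 1 by [].
  by case: n_k => /[dup] n_eq /boundE; rewrite ?b1 ?b2; lia.
- have domT : dominating (@petersen2 n) S.
    apply/forallP => x; have [->|/domS] := eqVneq x (u_ f); last by [].
    apply: domf; rewrite !inE negb_or; apply/andP; split; apply/eqP => n5.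
      by apply: n_k; exists (n %/ 5); lia.
    by apply: n_k; exists (n %/ 5); lia.
  have ubP : gammaP <= bound n.
    by rewrite -cardS; apply: (domination_numberP _).2.
  have := leq_bound lbP; lia.
Qed.
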